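(* Let $p$ be a prime and let $G$ be a metabelian maximal class $p$-group with $|G|=p^{n}$. Then $\mathrm{cod}(G)=\{p^i\mid 0\le i\le c\}$ where $c=n-1$ or $c=n-2$.
   Context: All groups are finite. $\mathrm{Irr}(G)$ is the set of irreducible complex characters of $G$. The codegree of $\chi\in\mathrm{Irr}(G)$ is $\mathrm{cod}(\chi)=|G:\ker(\chi)|/\chi(1)$, and $\mathrm{cod}(G)=\{\mathrm{cod}(\chi)\mid\chi\in\mathrm{Irr}(G)\}$. A $p$-group of order $p^n$ has maximal class if $n\ge 3$ and its nilpotence class is $n-1$ (in particular, it is nonabelian). A group $G$ is metabelian if its commutator subgroup $G'$ is abelian. *)

(* Defs.v *)
From mathcomp Require Import all_boot all_order all_algebra.
From mathcomp Require Import all_fingroup all_solvable all_field all_character.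

Set Implicit Arguments.
Unset Strict Implicit.
Unset Printing Implicit Defensive.

Import GroupScope GRing.Theory Num.Theory.
Local Open Scope ring_scope.

(* The quotient is taken in algC, where character values live; no divisibility
   of #|G : cfker chi| by the degree of chi is presupposed. *)
Definition cod (gT : finGroupType) (G : {group gT}) (chi : 'CF(G)) : algC :=
  (#|G : cfker chi|%g)%:R / chi 1%g.

(* A list of values that stands for a set: repetitions and order are
   irrelevant, only membership is meaningful. *)
Definition codegrees (gT : finGroupType) (G : {group gT}) : seq algC :=
  [seq cod chi | chi <- irr G].

Definition metabelian (gT : finGroupType) (G : {group gT}) : bool :=
  abelian (G^`(1))%g.

(* For a p-group G with p prime, logn p #|G| is the n such that |G| = p^n. *)
Definition maximal_class (p : nat) (gT : finGroupType) (G : {group gT}) : bool :=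
  [&& p.-group G, (3 <= logn p #|G|)%N & nil_class G == (logn p #|G|).-1].

(* Main.v *)
Require Import Defs.
From mathcomp Require Import all_boot all_order all_algebra.
From mathcomp Require Import all_fingroup all_solvable all_field all_character.

Import Order.TTheory GroupScope GRing.Theory Num.Theory.

Local Open Scope ring_scope.

(* Write L_k for the k-th term of the lower central series, L_2 = G'. In a
   maximal class group of order p^n, L_k is the only normal subgroup of index
   p^k for 2 <= k <= n, and it is the kernel of some irreducible character when
   k >= 3. Since G' is abelian of index p^2, every irreducible character has
   degree 1, p or p^2, so those with kernel L_k, k >= 3, have codegree p^(k-1)
   or p^(k-2).
   If an irreducible character with kernel L_(k+1) has degree p, then either
   its restriction to G' is homogeneous, so that L_3 <= L_(k+1), or by Clifford
   theory it is induced from a subgroup T of index p with T' <= L_(k+1). Both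
   ways a character with kernel L_k has degree at most p: its degree squared is
   at most |G : L_3| = p^3, or its restriction to T has linear constituents.
   Hence p^k, 2 <= k <= n - 2, is always attained: by a character with kernel
   L_(k+1) if it has degree p, and otherwise by one with kernel L_(k+2), whose
   degree must then be p^2. The codegree p^(n-1) may or may not occur, and p^n
   cannot. *)

(** * Degrees, kernels and Clifford theory *)

Lemma constt_Res_lin {gT : finGroupType} {G H : {group gT}}
    {i : Iirr G} {j : Iirr H} :
    H \subset G -> H^`(1)%g \subset cfker 'chi_i ->
  j \in irr_constt ('Res[H] 'chi_i) -> 'chi_j \is a linear_char.
Proof.
move=> sHG sH'K ij; rewrite lin_irr_der1.
apply: subset_trans (cfker_constt (cfRes_char H (irr_char i)) ij).
by rewrite cfker_Res ?irr_char // subsetI der_sub.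
Qed.

(** By Frobenius reciprocity ['chi_i] is a constituent of a linear character of [H] induced to
    [G]. *)
Lemma irr1_le_index_der1_cfker {gT : finGroupType} {G H : {group gT}}
    {i : Iirr G} :
    H \subset G -> H^`(1)%g \subset cfker 'chi_i ->
  'chi_i 1%g <= #|G : H|%g%:R.
Proof.
move=> sHG sH'K.
have [j ij] := constt_cfRes_irr H i.
have /lin_char1 lin_j := constt_Res_lin sHG sH'K ij.
move: ij; rewrite -constt_Ind_Res.
move=> /(char1_ge_constt (cfInd_char _ (irr_char j))).
by rewrite cfInd1 // lin_j mulr1.
Qed.

Lemma irr1_sqr_le_index_cfker {gT : finGroupType} {G : {group gT}} (i : Iirr G) :
  'chi_i 1%g ^+ 2 <= #|G : cfker 'chi_i|%g%:R.
Proof.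
have [le_i _] := irr1_bound i; apply: le_trans le_i _.
by rewrite ler_nat dvdn_leq // indexgS // normal_sub // cfker_center_normal.
Qed.

(** By Clifford's theorem ['chi_i] restricts to [A] as a multiple of ['chi_j], and an invariant
    linear character is trivial on each [[~ x, g]]. *)
Lemma cfker_comm_invariant_lin {gT : finGroupType} {G A : {group gT}}
    {i : Iirr G} {j : Iirr A} :
    A <| G -> j \in irr_constt ('Res[A] 'chi_i) -> 'chi_j \is a linear_char ->
  G \subset 'I['chi_j] -> [~: A, G]%g \subset cfker 'chi_i.
Proof.
move=> nsAG ij lin_j inv_j.
have [sAG nAG] := andP nsAG.
rewrite gen_subG; apply/subsetP=> _ /imset2P[x g Ax Gg ->].
have Gx := subsetP sAG x Ax; have Ar : [~ x, g] \in A.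
  by rewrite groupM ?groupV // memJ_norm // (subsetP nAG).
have Dres := Clifford_Res_sum_cfclass nsAG ij.
rewrite cfclass_invariant // big_seq1 in Dres.
rewrite /= cfkerEchar ?irr_char // inE groupR //= -(cfResE _ sAG) //.
rewrite -[X in _ == X](cfResE _ sAG) //.
rewrite Dres !cfunE /commg lin_charM ?groupV ?memJ_norm ?(subsetP nAG) //.
by rewrite inertia_valJ ?(subsetP inv_j) // -lin_charM ?groupV // mulVg.
Qed.

(** [T] is the inertia group of a constituent on [G']. Since ['chi_i] is induced from [T], the index
    of [T] divides [p]: index 1 is the homogeneous case, and at index [p] the Clifford correspondent
    is linear. *)
Lemma irr_prime_degree_cases {gT : finGroupType} {G : {group gT}} {p : nat}
    {i : Iirr G} :
    metabelian G -> prime p -> 'chi_i 1%g = p%:R ->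
  [~: G^`(1), G]%g \subset cfker 'chi_i \/
  exists T : {group gT},
    [/\ T \subset G, #|G : T|%g = p & T^`(1)%g \subset cfker 'chi_i].
Proof.
move=> abA p_pr i1; set A := (G^`(1))%G; have nsAG : A <| G := der_normal 1 G.
have sAG := normal_sub nsAG.
have [j ij] := constt_cfRes_irr A i.
have lin_j : 'chi_j \is a linear_char by apply/char_abelianP.
have [Ind_irr _ im_Ind _ _] := constt_Inertia_bijection j nsAG.
move: (ij); rewrite -constt_Ind_Res -im_Ind => /imsetP[s s_in Di].
set T := ('I_G['chi_j])%G in s s_in Di.
have sTG : T \subset G := Inertia_sub G 'chi_j.
have sAT : A \subset T by apply: sub_Inertia.
have nsTG : T <| G by apply: sub_der1_normal.
have [eqTG | neqTG] := eqVneq #|G : T|%g 1%N.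
  left; apply: (cfker_comm_invariant_lin nsAG ij lin_j).
  by apply: subset_trans (subsetIr G _); rewrite -indexg_eq1; apply/eqP.
have Dchi : 'chi_i = 'Ind[G] 'chi_s by rewrite Di cfIirrE ?Ind_irr.
have /natrP[d s1] := Cnat_irr1 s.
have : (#|G : T|%g * d)%N = p.
  by apply/eqP; rewrite -eqC_nat natrM -s1 -cfInd1 // -Dchi i1.
move=> dvd_p; have /(prime_nt_dvdP p_pr neqTG) oT : (#|G : T|%g %| p)%N.
  by rewrite -dvd_p dvdn_mulr.
right; exists T; split=> //.
(* The kernel of the induced character is the core of the kernel of ['chi_s], and [T'] is normalised
   by [G]. *)
rewrite Dchi cfker_Ind_irr // sub_gcore; last first.
  exact: gFnorm_trans (normal_norm nsTG).
rewrite -lin_irr_der1. rewrite qualifE /= irr_char s1 pnatr_eq1.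
by move/eqP: dvd_p; rewrite oT -[X in _ == X]muln1 eqn_pmul2l ?prime_gt0.
Qed.

Lemma pgroup_irr1 {gT : finGroupType} {G : {group gT}} {p : nat} (i : Iirr G) :
  prime p -> p.-group G -> exists a : nat, 'chi_i 1%g = (p ^ a)%:R.
Proof.
move=> p_pr pG; have /natrP[d d1] := Cnat_irr1 i.
have := dvd_irr1_cardG i; rewrite d1 dvdC_nat (card_pgroup pG).
by case/(dvdn_pfactor _ _ p_pr)=> a _ ->; exists a.
Qed.

Lemma irr1_le_prime {gT : finGroupType} {G : {group gT}} {p : nat}
    {i j : Iirr G} :
    metabelian G -> prime p -> p.-group G -> (#|G : 'L_3(G)|%g <= p ^ 3)%N ->
    'chi_i 1%g = p%:R -> cfker 'chi_i \subset cfker 'chi_j ->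
  'chi_j 1%g <= p%:R.
Proof.
move=> metaG p_pr pG iL3 i1 sKij; have p_gt1 := prime_gt1 p_pr.
have [sL3 | [T [sTG oT sT'K]]] := irr_prime_degree_cases metaG p_pr i1; last first.
  rewrite -oT; apply: irr1_le_index_der1_cfker => //.
  exact: subset_trans sKij.
have [b b1] := pgroup_irr1 j p_pr pG.
have := irr1_sqr_le_index_cfker j; rewrite b1 -natrX !ler_nat => le_b.
have sLKj : 'L_3(G) \subset cfker 'chi_j by apply: subset_trans sKij.
have le_iK : (#|G : cfker 'chi_j|%g <= p ^ 3)%N.
  by apply: leq_trans iL3; apply: dvdn_leq (indexgS _ sLKj).
have := leq_trans le_b le_iK; rewrite -expnM leq_exp2l // => le_b3.
by rewrite -{2}(expn1 p) leq_exp2l //; case: b le_b3 {le_b b1} => [|[|[]]].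
Qed.

(** * Normal subgroups of maximal class groups *)

Lemma maximal_class_index_lcn {gT : finGroupType} {G : {group gT}} {p k : nat} :
    prime p -> maximal_class p G -> (2 <= k <= logn p #|G|)%N ->
  #|G : 'L_k(G)|%g = (p ^ k)%N.
Proof.
move=> p_pr /and3P[pG n3 /eqP clG] /andP[k2 kn].
set n := logn p #|G| in n3 clG kn; have nilG := pgroup_nil pG.
have iL m : (logn p #|'L_m(G)| + logn p #|G : 'L_m(G)|%g = n)%N.
  by rewrite -lognM ?cardG_gt0 ?indexg_gt0 // Lagrange // lcn_sub.
have pL m : p.-group 'L_m(G) := pgroupS (lcn_sub m G) pG.
(* The class is [n - 1], so [L_(m+1)] is nontrivial here, and nilpotency makes the next term
   proper. *)
have ltL m : (m.+1 < n)%N -> (logn p #|'L_m.+2(G)| < logn p #|'L_m.+1(G)|)%N.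
  move=> mn; apply: properG_ltn_log; first exact: pL.
  rewrite /= lcnSn; apply: (nil_comm_properl nilG); rewrite ?lcn_sub //.
    apply: contraTneq mn => /(introT (lcn_nil_classP m nilG)).
    by rewrite clG -leqNgt -[in X in _ -> X](prednK (ltnW (ltnW n3))) ltnS.
  by rewrite subsetI subxx lcn_norm.
(* There are [d] strict inclusions between [L_(n-d)] and [L_n]. *)
have lower d : (d < n)%N -> (d <= logn p #|'L_(n - d)(G)|)%N.
  elim: d => // d IHd dn; apply: leq_ltn_trans (IHd (ltnW dn)) _.
  rewrite -(subnSK (ltnW dn)); case Dm: (n - d.+1)%N => [|m].
    by move/eqP: Dm; rewrite subn_eq0 leqNgt dn.
  by apply: ltL; rewrite -Dm ltn_subrL (leq_trans _ n3).
(* Descending from [G'], of index at least [p ^ 2], each strict inclusion gains another factor [p].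
   This meets the previous bound exactly. *)
have upper d : (d.+2 <= n)%N -> (d.+2 + logn p #|'L_d.+2(G)| <= n)%N.
  elim: d => [_ | d IHd dn]; last first.
    by apply: leq_trans (IHd (ltnW dn)); rewrite addSnnS leq_add2l ltL.
  rewrite addnC -(iL 2) leq_add2l ltnNge; apply: contraL n3 => iG'.
  (* A cyclic [G / G'] would make the nilpotent group [G] cyclic, hence of class at most 1. *)
  suffices /cyclic_abelian : cyclic G.
    by rewrite -nil_class1 clG -!subn1 leq_subLR -ltnS -leqNgt.
  apply: cyclic_nilpotent_quo_der1_cyclic nilG _.
  apply: (dvdn_prime_cyclic p_pr).
  rewrite (card_pgroup (quotient_pgroup _ pG)) card_quotient ?der_norm // /= -lcn2.
  by rewrite -[X in (_ %| X)%N]expn1 dvdn_exp2l.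
have pQ : p.-group (G / 'L_k(G))%g by apply: quotient_pgroup.
rewrite -card_quotient ?lcn_norm // (card_pgroup pQ) card_quotient ?lcn_norm //.
congr (p ^ _)%N; apply/eqP; rewrite -(eqn_add2l (logn p #|'L_k(G)|)) iL eqn_leq.
have kL := upper (k - 2)%N; rewrite -(addn2 (k - 2)) subnK // in kL.
rewrite addnC kL // andbT -leq_subLR.
have := lower (n - k)%N; rewrite subKn // => -> //.
by rewrite ltn_subrL (leq_trans _ k2) // (leq_trans _ n3).
Qed.

(** The quotient by [N] has order [p ^ k], so its class is below [k] and [L_k] lies in [N]; the
    indices agree. *)
Lemma maximal_class_normal_lcn {gT : finGroupType} {G N : {group gT}}
    {p k : nat} :
    prime p -> maximal_class p G -> N <| G -> (2 <= k)%N ->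
  #|G : N|%g = (p ^ k)%N -> N :=: 'L_k(G).
Proof.
move=> p_pr mcG nsNG k2 iN; have /and3P[pG _ _] := mcG.
have [sNG nNG] := andP nsNG.
have kn : (k <= logn p #|G|)%N.
  rewrite -(Lagrange sNG) iN lognM ?cardG_gt0 ?expn_gt0 ?prime_gt0 //.
  by rewrite pfactorK // leq_addl.
have iL : #|G : 'L_k(G)|%g = (p ^ k)%N.
  by apply: maximal_class_index_lcn; rewrite ?k2.
have pQ : p.-group (G / N)%g by apply: quotient_pgroup.
have sLN : 'L_k(G) \subset N.
  rewrite -quotient_sub1 ?(subset_trans (lcn_sub _ _)) //.
  rewrite quotientE morphim_lcn //.
  rewrite -quotientE; apply/trivgP.
  case: k k2 {kn} iN {iL} => // k k2 iN; apply/(lcn_nil_classP k (pgroup_nil pQ)).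
  apply: leq_trans (nil_class_pgroup pQ) _.
  by rewrite card_quotient // iN pfactorK //= geq_max -ltnS k2 leqnn.
apply/eqP; rewrite eq_sym eqEcard sLN /=.
rewrite -(leq_pmul2r (indexg_gt0 G N)) Lagrange // iN -iL.
by rewrite Lagrange // lcn_sub.
Qed.

(** * Irreducible characters with kernels of prescribed index *)

Lemma exists_irr_cfker_between {gT : finGroupType} {G H N : {group gT}} :
    N <| G -> ~~ (H \subset N) ->
  exists i : Iirr G, N \subset cfker 'chi_i /\ ~~ (H \subset cfker 'chi_i).
Proof.
(* [N] is the intersection of the irreducible kernels containing it, so some such kernel misses part
   of [H]. *)
move=> nsNG; rewrite -{1}(cap_cfker_normal nsNG).
have [/existsP[i /andP[sNi nsHi]] _ | ] :=
  boolP [exists i : Iirr G,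
           (N \subset cfker 'chi_i) && ~~ (H \subset cfker 'chi_i)].
  by exists i.
move=> /existsPn all_i /bigcapsP[] i sNi.
by have := all_i i; rewrite sNi /= negbK.
Qed.

Lemma irr_index_cfker_pfactor {gT : finGroupType} {G : {group gT}} {p n : nat}
    (i : Iirr G) :
    prime p -> #|G| = (p ^ n)%N ->
  exists2 m : nat, (m <= n)%N & #|G : cfker 'chi_i|%g = (p ^ m)%N.
Proof.
by move=> p_pr oG; apply/dvdn_pfactor; rewrite // -oG dvdn_indexg.
Qed.

Lemma pgroup_exists_irr_index_cfker_prime {gT : finGroupType} {G : {group gT}}
    {p : nat} :
    p.-group G -> G :!=: 1%g -> prime p ->
  exists i : Iirr G, #|G : cfker 'chi_i|%g = p.
Proof.
move=> pG ntG p_pr; have [defG | [M maxM _]] := maximal_exists (sub1G G).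
  by rewrite -defG eqxx in ntG.
have [i [sMi nsGi]] := exists_irr_cfker_between (p_maximal_normal pG maxM)
  (proper_subn (maxgroupp maxM)).
exists i; apply/(prime_nt_dvdP p_pr).
  by rewrite indexg_eq1.
by rewrite -(p_maximal_index pG maxM) indexgS.
Qed.

(** Take a kernel containing [L_k] but not [L_(k-1)]. If its index were [p ^ m] with [2 <= m < k],
    it would be [L_m], which contains [L_(k-1)]. *)
Lemma maximal_class_exists_irr_index_cfker {gT : finGroupType} {G : {group gT}}
    {p k : nat} :
    prime p -> maximal_class p G -> (2 < k <= logn p #|G|)%N ->
  exists i : Iirr G, #|G : cfker 'chi_i|%g = (p ^ k)%N.
Proof.
move=> p_pr mcG; case: k => // k /andP[]; rewrite ltnS => k2 kn.
have /and3P[pG _ _] := mcG; have p_gt1 := prime_gt1 p_pr.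
have iLk : #|G : 'L_k(G)|%g = (p ^ k)%N.
  by apply: maximal_class_index_lcn; rewrite // k2 ltnW.
have iLk1 : #|G : 'L_k.+1(G)|%g = (p ^ k.+1)%N.
  by apply: maximal_class_index_lcn; rewrite // kn ltnW.
have nsL : ~~ ('L_k(G) \subset 'L_k.+1(G)).
  apply/negP=> /(indexgS G)/(dvdn_leq (indexg_gt0 _ _)).
  by rewrite iLk iLk1 leq_exp2l // ltnn.
have [i [sLi nsLi]] := exists_irr_cfker_between (lcn_normal k.+1 G) nsL.
exists i; have [m mn im] := irr_index_cfker_pfactor i p_pr (card_pgroup pG).
rewrite im; congr (p ^ _)%N; apply/eqP; rewrite eqn_leq; apply/andP; split.
  rewrite -(leq_exp2l _ _ p_gt1) -im -iLk1.
  by apply: dvdn_leq; rewrite ?indexg_gt0 ?indexgS.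
rewrite ltnNge; apply: contra nsLi => mk.
have [m2 | m2] := ltnP 1 m.
  rewrite (maximal_class_normal_lcn p_pr mcG (cfker_normal _) m2 im).
  exact: lcn_sub_leq.
(* With a kernel of index at most [p] the character is linear, so its kernel contains [G']. *)
apply: subset_trans (lcn_sub_leq G k2) _; rewrite lcn2 -lin_irr_der1.
have [a a1] := pgroup_irr1 i p_pr pG.
rewrite qualifE /= irr_char a1 pnatr_eq1; have := irr1_sqr_le_index_cfker i.
rewrite a1 im -natrX ler_nat -expnM leq_exp2l //.
by case: a {a1} => // a; rewrite mulSn => le_m; have := leq_trans le_m m2.
Qed.

(** * Codegrees *)

Lemma codegreesP {gT : finGroupType} {G : {group gT}} {x : algC} :
  reflect (exists i : Iirr G, x = cod 'chi_i) (x \in codegrees G).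
Proof.
apply: (iffP mapP) => [[_ /irrP[i ->] ->] | [i ->]]; first by exists i.
by exists 'chi_i; first exact: mem_irr.
Qed.

Lemma codE {gT : finGroupType} {G : {group gT}} {p m a : nat} {chi : 'CF(G)} :
    prime p -> #|G : cfker chi|%g = (p ^ m)%N -> chi 1%g = (p ^ a)%:R ->
  (a <= m)%N -> cod chi = (p ^ (m - a))%:R.
Proof.
move=> p_pr im a1 am; rewrite /cod im a1 -{1}(subnK am) expnD natrM mulfK //.
by rewrite pnatr_eq0 -lt0n expn_gt0 prime_gt0.
Qed.

Theorem corollaryC (gT : finGroupType) (G : {group gT}) (p n : nat)
    (p_pr : prime p) (metaG : metabelian G) (maxG : maximal_class p G)
    (oG : #|G| = (p ^ n)%N) :
  exists c : nat, (c = (n - 1)%N \/ c = (n - 2)%N) /\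
    (forall x : algC,
       x \in codegrees G <-> exists2 i : nat, (0 <= i <= c)%N & x = (p ^ i)%:R).
Proof.
have /and3P[pG n3 _] := maxG; have p_gt1 := prime_gt1 p_pr.
have logG : logn p #|G| = n by rewrite oG pfactorK.
rewrite logG in n3.
have iL k : (1 < k <= n)%N -> #|G : 'L_k(G)|%g = (p ^ k)%N.
  by move=> kn; apply: maximal_class_index_lcn; rewrite ?logG.
have iG' : #|G : G^`(1)|%g = (p ^ 2)%N by rewrite -lcn2; apply: iL; exact: ltnW.
have degP (i : Iirr G) m : #|G : cfker 'chi_i|%g = (p ^ m)%N ->
    exists a, [/\ 'chi_i 1%g = (p ^ a)%:R, (a <= 2)%N, (a * 2 <= m)%N
      & (2 < m)%N -> (0 < a)%N].
  move=> im; have [a a1] := pgroup_irr1 i p_pr pG; exists a; split=> //.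
  - rewrite -(leq_exp2l _ _ p_gt1) -(ler_nat algC) -a1 -iG'.
    apply: irr1_le_index_der1_cfker; first exact: der_sub.
    by rewrite (derG1P metaG) sub1G.
  - have := irr1_sqr_le_index_cfker i.
    by rewrite a1 im -natrX ler_nat -expnM leq_exp2l.
  apply: contraTltn; rewrite leqn0 => /eqP a0; rewrite -leqNgt.
  have lin_i : 'chi_i \is a linear_char.
    by rewrite qualifE /= irr_char a1 a0 expn0 eqxx.
  rewrite -(leq_exp2l _ _ p_gt1) -im -iG' dvdn_leq ?indexgS //.
  by rewrite -lin_irr_der1.
have bounded (i : Iirr G) : exists2 k, (k < n)%N & cod 'chi_i = (p ^ k)%:R.
  have [m mn im] := irr_index_cfker_pfactor i p_pr oG.
  have [a [a1 _ am a_gt0]] := degP i m im.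
  have a_le_m : (a <= m)%N by apply: leq_trans am; rewrite leq_pmulr.
  exists (m - a)%N; last exact: codE.
  (* Exponent [n] is excluded: for [m > 2] a nonlinear degree lowers it, and otherwise
     [m <= 2 < n]. *)
  have [/a_gt0 a_pos | m2] := ltnP 2 m.
    by apply: leq_trans mn; rewrite ltn_subrL a_pos (leq_trans a_pos).
  by apply: leq_ltn_trans (leq_subr _ _) (leq_ltn_trans m2 n3).
have attained k : (k <= n - 2)%N -> exists i : Iirr G, cod 'chi_i = (p ^ k)%:R.
  case: k => [_ | [_ | k kn]].
  - exists 0; rewrite (codE (m := 0) (a := 0) p_pr) //.
      by rewrite cfker_irr0 indexgg.
    by rewrite irr0 cfun11.
  - have ntG : G :!=: 1%g.
      by rewrite -cardG_gt1 oG -(expn0 p) ltn_exp2l // ltnW // ltnW.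
    have [i im] := pgroup_exists_irr_index_cfker_prime pG ntG p_pr.
    (* Here [a * 2 <= 1] forces degree 1. *)
    exists i; have [[|a] [a1 _ am _]] := degP i 1%N im => //.
    exact: (codE (m := 1) p_pr im a1).
  (* The target exponent is now [k.+2], and [k.+4 <= n] leaves room for both kernels. *)
  rewrite leq_subRL ?(ltnW n3) // add2n in kn.
  have [i im] : exists i : Iirr G, #|G : cfker 'chi_i|%g = (p ^ k.+3)%N.
    apply: maximal_class_exists_irr_index_cfker => //.
    by rewrite logG; exact: ltnW.
  have [j jm] : exists j : Iirr G, #|G : cfker 'chi_j|%g = (p ^ k.+4)%N.
    by apply: maximal_class_exists_irr_index_cfker => //; rewrite logG.
  have [a [a1 a2 _ a_gt0]] := degP i _ im.
  have [b [b1 b2 _ b_gt0]] := degP j _ jm.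
  have [a_eq1 | a_neq1] := eqVneq a 1%N.
    by exists i; rewrite (codE p_pr im a1) a_eq1 // subn1.
  have [b_eq1 | b_neq1] := eqVneq b 1%N; last first.
    exists j; have b_eq2 : b = 2%N by case: (b) b2 (b_gt0 isT) b_neq1 => [|[|[]]].
    by rewrite (codE p_pr jm b1) b_eq2 // subn2.
  (* Degree [p] for ['chi_j], whose kernel is the smaller one, forces degree [p] for ['chi_i]
     too. *)
  case/eqP: a_neq1; apply/eqP; rewrite eqn_leq a_gt0 // andbT.
  rewrite -(leq_exp2l _ _ p_gt1) -(ler_nat algC) -a1 expn1.
  apply: (irr1_le_prime (i := j)) => //.
  - by rewrite iL.
  - by rewrite b1 b_eq1 expn1.
  rewrite (maximal_class_normal_lcn p_pr maxG (cfker_normal _) _ jm) //.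
  rewrite (maximal_class_normal_lcn p_pr maxG (cfker_normal _) _ im) //.
  exact: lcn_sub_leq.
have n1 : (n - 1)%N = (n - 2).+1 by rewrite -subnSK // ltnW.
(* Only the exponent [n - 1] is undecided, and it determines [c]. *)
have [top | not_top] := boolP ((p ^ (n - 1))%:R \in codegrees G).
  exists (n - 1)%N; split; first by left.
  move=> x; split=> [/codegreesP[i ->] | [k /= le_k ->]].
    have [k kn ->] := bounded i; exists k => //=.
    by rewrite subn1 -ltnS prednK // ltnW // ltnW.
  move: le_k; rewrite n1 leq_eqVlt -n1 => /predU1P[-> // | ].
  by rewrite n1 ltnS => /attained[i <-]; apply/codegreesP; exists i.
exists (n - 2)%N; split; first by right.
move=> x; split=> [/codegreesP[i ->] | [k /= /attained[i <-] ->]].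
  have [k kn cod_i] := bounded i; exists k => //=.
  have : (k <= n - 1)%N by rewrite subn1 -ltnS prednK // ltnW // ltnW.
  rewrite n1 leq_eqVlt -n1 => /predU1P[k_top | ]; last by rewrite n1.
  by case/negP: not_top; rewrite -k_top -cod_i; apply/codegreesP; exists i.
by apply/codegreesP; exists i.
Qed.
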